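(* Let $\rho \in (0,+\infty)$ and let $\overline{B}_\rho := \{u \in C([0,1]) : \|u\|_\infty \le \rho\}$, $\partial B_\rho := \{u \in C([0,1]) : \|u\|_\infty = \rho\}$, where $\|u\|_\infty = \sup_{t\in[0,1]}|u(t)|$. Assume that: (1) $k : [0,1]^2 \to [0,+\infty)$ is continuous; (2) $H : \overline{B}_\rho \to \mathbb{R}$ is continuous and there exist $\underline{H_\rho}, \overline{H_\rho} \in \mathbb{R}$ such that $\underline{H_\rho} \le H[u] \le \overline{H_\rho}$ for every $u \in \overline{B}_\rho$; (3) $f : \Pi_\rho \to \mathbb{R}$ is continuous, where $\Pi_\rho := [0,1]\times[-\rho,\rho]\times[\underline{H_\rho},\overline{H_\rho}] \subset \mathbb{R}^3$; (4) there exist continuous functions $\underline{f_\rho}, \overline{f_\rho} : [0,1] \to \mathbb{R}$ such that $\underline{f_\rho}(t) \le f(t,u,v) \le \overline{f_\rho}(t)$ for every $(t,u,v) \in \Pi_\rho$; (5) setting $\underline{F_\rho}(t) := \int_0^1 k(t,s)\underline{f_\rho}(s)\,ds$ and $\overline{F_\rho}(t) := \int_0^1 k(t,s)\overline{f_\rho}(s)\,ds$, at least one of the following holds: (5a) there exists $t_\rho \in [0,1]$ with $\overline{F_\rho}(t_\rho) < 0$; (5b) there exists $t_\rho \in [0,1]$ with $\underline{F_\rho}(t_\rho) > 0$. Then there exist $\lambda_\rho^+ > 0$, $\lambda_\rho^- < 0$ and $u^+, u^- \in \partial B_\rho$ such that $(\lambda,u) = (\lambda_\rho^+,u^+)$ and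 $(\lambda,u) = (\lambda_\rho^-,u^-)$ both satisfy $$u(t) = \lambda \int_0^1 k(t,s)\, f(s,u(s),H[u])\,ds \quad \text{for all } t \in [0,1].$$ Furthermore, if $\lambda_\rho \in \mathbb{R}$ and $u_\rho \in \overline{B}_\rho$ satisfy $u_\rho(t) = \lambda_\rho \int_0^1 k(t,s)\, f(s,u_\rho(s),H[u_\rho])\,ds$ for all $t\in[0,1]$, then: (6a) if (5a) holds, $|\lambda_\rho| \le -\dfrac{\rho}{\overline{F_\rho}(t_\rho)}$; (6b) if (5b) holds, $|\lambda_\rho| \le \dfrac{\rho}{\underline{F_\rho}(t_\rho)}$.
   Context: $C([0,1])$ denotes the Banach space of real-valued continuous functions on $[0,1]$ with the supremum norm $\|\cdot\|_\infty$. *)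

(* Defs.v *)
From HB Require Import structures.
From mathcomp Require Import all_boot all_order all_algebra.
From mathcomp Require Import all_classical all_reals all_analysis.
Set Implicit Arguments. Unset Strict Implicit. Unset Printing Implicit Defensive.
Import Order.TTheory GRing.Theory Num.Theory.
Import numFieldNormedType.Exports.
Local Open Scope classical_set_scope.
Local Open Scope ring_scope.

(* Elements of C([0,1]) are represented by functions u : R -> R that are
   continuous on [0,1]; only their values on [0,1] matter. *)
Definition C01 (R : realType) (u : R -> R) : Prop :=
  {within `[0, 1], continuous u}.

Definition supnorm (R : realType) (u : R -> R) : R :=
  sup [set `|u t| | t in `[(0:R), 1]].

Definition cont_on_ball (R : realType) (rho : R) (H : (R -> R) -> R) : Prop :=
  forall u, C01 u -> supnorm u <= rho ->
  forall e : R, 0 < e -> exists2 d : R, 0 < d &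
    forall v, C01 v -> supnorm v <= rho ->
      supnorm (fun t => u t - v t) < d -> `|H u - H v| < e.

Definition I01 (R : realType) (g : R -> R) : R :=
  \int[@lebesgue_measure R]_(s in `[(0:R), 1]) g s.

(* Main.v *)
Require Import Defs.
From HB Require Import structures.
From mathcomp Require Import all_boot all_order all_algebra.
From mathcomp Require Import all_classical all_reals all_analysis.
From mathcomp Require Import ring lra.
Import Order.TTheory GRing.Theory Num.Theory.
Import numFieldNormedType.Exports.
Local Open Scope classical_set_scope.
Local Open Scope ring_scope.

(* For u in the closed ball of radius rho, let T u be the right-hand integral.
   Hypothesis (5) keeps the sup norm of T u away from 0, so
   u |-> +-rho T u / |T u| is a continuous self-map of the ball with
   equicontinuous image; a fixed point has norm rho and solves the equation
   with lambda = +-rho / |T u|.  Interpolating at equally spaced nodes reduces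
   Schauder's theorem to Brouwer's theorem on a cube of node values, an
   ultralimit recovering the fixed point.  Brouwer's theorem comes from a
   cubical Sperner lemma: for 0/1 labels a_i on a grid with a_i = 0 and a_i = 1
   on the opposite i-th faces, the discrete form da_1 ... da_N mod 2 is exact,
   hence by Stokes its sum over all cells is 1, so that some cell sees every
   a_i change.  The bounds on lambda evaluate the equation at t_rho. *)

(** * Cubical Sperner lemma by cochains modulo 2 *)

Section CubicalSperner.
Variable N : nat.
Implicit Types (z : 'I_N -> nat) (A : {set 'I_N}) (s : seq 'I_N).
Implicit Types F : ('I_N -> nat) -> 'F_2.

(** Grid points are unbounded functions to [nat], so that [step] is total; the size of the grid
    enters only through the ranges of the box sums. *)
Definition set_coord z (d : 'I_N) (v : nat) : 'I_N -> nat :=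
  fun i => if i == d then v else z i.

Definition step z (d : 'I_N) : 'I_N -> nat := set_coord z d (z d).+1.

Lemma addrr_F2 (x : 'F_2) : x + x = 0.
Proof. by apply: addrr_pchar2; exact: pchar_Fp. Qed.

Lemma oppr_F2 (x : 'F_2) : - x = x.
Proof. by apply/eqP; rewrite eq_sym -addr_eq0 addrr_F2. Qed.

Lemma set_coordC z d e v w : d != e ->
  set_coord (set_coord z d v) e w = set_coord (set_coord z e w) d v.
Proof.
move=> de; apply/funext => i; rewrite /set_coord.
by case: (eqVneq i e) => // ->; rewrite eq_sym (negbTE de).
Qed.

Lemma step_set_coord z d v : step (set_coord z d v) d = set_coord z d v.+1.
Proof.
by apply/funext => i; rewrite /step /set_coord eqxx; case: (i == d).
Qed.

Lemma stepC z d e : step (step z d) e = step (step z e) d.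
Proof.
case: (eqVneq d e) => [->//|de]; apply/funext => i; rewrite /step /set_coord.
case: (eqVneq i e) => [->|ie]; case: (eqVneq i d) => [id|id] //=.
- by rewrite eq_sym (negbTE de).
- by rewrite eq_sym (negbTE de).
- by rewrite (negbTE de).
Qed.

(** Each unordered pair of distinct directions is counted twice, which is 0 in characteristic 2: the
    cancellation behind the vanishing of the squared coboundary. *)
Lemma sum_sym_F2 A (G : 'I_N -> 'I_N -> 'F_2) :
  (forall c d, G c d = G d c) ->
  \sum_(d in A) \sum_(c in A :\ d) G c d = 0.
Proof.
move=> Gsym.
have -> : \sum_(d in A) \sum_(c in A :\ d) G c d =
  \sum_(d : 'I_N | d \in A) \sum_(c in A | (c < d)%N) G c d +
  \sum_(d : 'I_N | d \in A) \sum_(c in A | (d < c)%N) G c d.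
  rewrite -big_split; apply: eq_bigr => d dA /=.
  rewrite (bigID (fun c : 'I_N => (c < d)%N)) /=; congr (_ + _);
  apply: eq_bigl => c; rewrite !inE -(inj_eq val_inj) /=;
  by case: (ltngtP c d); rewrite ?andbT ?andbF.
rewrite [X in _ + X](exchange_big_dep (fun c => c \in A)) /=; last first.
  by move=> i j _ /andP[].
rewrite (eq_bigr (fun d : 'I_N => \sum_(c in A | (c < d)%N) G d c)); last first.
  by move=> d _; apply: eq_bigr => c _; exact: Gsym.
rewrite -[RHS](addrr_F2
  (\sum_(d : 'I_N | d \in A) \sum_(c in A | (c < d)%N) G d c)).
congr (_ + _); apply: eq_bigr => d dA.
by apply: eq_bigl => c; rewrite dA.
Qed.

Variable a : 'I_N -> ('I_N -> nat) -> 'F_2.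

(* Coefficient at [z], in the directions [A], of the cup product of the
   differentials of the [a i], [i] in [s]: a sum over the monotone paths that
   start at [z] and use distinct directions of [A]. *)
Fixpoint cup s A z : 'F_2 :=
  if s is i :: s' then
    \sum_(d in A) (a i (step z d) + a i z) * cup s' (A :\ d) (step z d)
  else 1.

(** A product of differentials is closed: the left-hand side is its coboundary modulo 2. Unfolding
    one factor gives a double sum over pairs of directions, split into symmetric parts and parts
    killed by the induction hypothesis. *)
Lemma cup_closed s A z :
  \sum_(d in A) (cup s (A :\ d) (step z d) + cup s (A :\ d) z) = 0.
Proof.
elim: s A z => [|b s IH] A z /=.
  by rewrite big1 // => d _; exact: addrr_F2.
pose X c d y := cup s (A :\ d :\ c) y.
have XC c d y : X c d y = X d c y.
  by rewrite /X; congr cup; apply/setP => j; rewrite !inE andbCA.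
(* [T1], [T3] and [T5] are symmetric in [c] and [d]; [T2] and [T4] are instances of the induction
   hypothesis. Their sum contains two extra products, each occurring twice, hence 0. *)
pose T1 c d := a b (step (step z d) c) * X c d (step (step z d) c).
pose T2 c d := a b (step z d) * (X c d (step (step z d) c) + X c d (step z d)).
pose T3 c d := a b (step z d) * X c d (step z d) + a b (step z c) * X c d (step z c).
pose T4 c d := a b z * (X c d (step z c) + X c d z).
pose T5 c d := a b z * X c d z.
have S1 : \sum_(d in A) \sum_(c in A :\ d) T1 c d = 0.
  by apply: sum_sym_F2 => c d; rewrite /T1 XC stepC.
have S2 : \sum_(d in A) \sum_(c in A :\ d) T2 c d = 0.
  by rewrite big1 // => d _; rewrite -mulr_sumr IH mulr0.
have S3 : \sum_(d in A) \sum_(c in A :\ d) T3 c d = 0.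
  by apply: sum_sym_F2 => c d; rewrite /T3 !(XC d c) addrC.
have S4 : \sum_(d in A) \sum_(c in A :\ d) T4 c d = 0.
  by rewrite big1 // => d _; rewrite -mulr_sumr IH mulr0.
have S5 : \sum_(d in A) \sum_(c in A :\ d) T5 c d = 0.
  by apply: sum_sym_F2 => c d; rewrite /T5 XC.
transitivity (\sum_(d in A) \sum_(c in A :\ d)
    (T1 c d + T2 c d + T3 c d + T4 c d + T5 c d)).
  apply: eq_bigr => d _; rewrite -big_split; apply: eq_bigr => c _ /=.
  rewrite /T1 /T2 /T3 /T4 /T5 -/(X c d _).
  rewrite !mulrDl !mulrDr.
  set x1 := _ * _; set x2 := _ * _; set x3 := _ * _; set x4 := _ * _.
  set x5 := _ * _; set x6 := _ * _.
  rewrite !addrA [RHS](AC 8 (1*2*5*6*(3*4)*(7*8)))%AC /=.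
  by rewrite !addrr_F2 !addr0.
clearbody T1 T2 T3 T4 T5; under eq_bigr => d _ do rewrite !big_split /=.
by rewrite !big_split /= S1 S2 S3 S4 S5 !addr0.
Qed.

(** Product rule: adding [a i z] times the closedness identity shows that [cup (i :: s)] is the
    coboundary of [a i] times [cup s]. *)
Lemma cup_exact i s A z : cup (i :: s) A z =
  \sum_(d in A) (a i (step z d) * cup s (A :\ d) (step z d) +
                 a i z * cup s (A :\ d) z).
Proof.
have /(congr1 (fun x => a i z * x)) := cup_closed s A z.
rewrite mulr0 mulr_sumr => E; rewrite -[LHS]addr0 -[X in _ + X = _]E /= -big_split.
apply: eq_bigr => d _ /=; rewrite mulrDl mulrDr addrA; congr (_ + _).
by rewrite -addrA addrr_F2 addr0.
Qed.

(** Some path has only nonzero factors, and [p], [q] are the ends of its edge for [i]. As the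
    directions used are distinct, the path stays in one cell. *)
Lemma cup_neq0 s A z : cup s A z != 0 -> forall i, i \in s ->
  exists p q, [/\ forall j, (z j <= p j <= z j + (j \in A))%N,
                  forall j, (z j <= q j <= z j + (j \in A))%N & a i p != a i q].
Proof.
elim: s A z => [//|b s IH] A z /= nz i.
have [d dA] : exists2 d, d \in A &
    (a b (step z d) + a b z) * cup s (A :\ d) (step z d) != 0.
  apply: contrapT => nE; move: nz; rewrite big1 ?eqxx// => d dA.
  by apply/eqP; apply: contrapT => /negP E; apply: nE; exists d.
rewrite mulf_eq0 negb_or => /andP[ab nz'].
have zd j : (z j <= step z d j <= z j + (j \in A))%N.
  rewrite /step /set_coord; case: (eqVneq j d) => [->|_].
    by rewrite dA leqnSn addn1 leqnn.
  by rewrite leqnn leq_addr.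
rewrite in_cons => /predU1P[->|si].
  exists (step z d), z; split => [//|j|].
    by rewrite leqnn leq_addr.
  by apply: contraNneq ab => ->; rewrite addrr_F2.
have [p [q [zp zq pq]]] := IH _ _ nz' i si.
have W x : (forall j, (step z d j <= x j <= step z d j + (j \in A :\ d))%N) ->
    forall j, (z j <= x j <= z j + (j \in A))%N.
  move=> xP j; have /andP[x1 x2] := xP j; apply/andP; split.
    by apply: leq_trans x1; case/andP: (zd j).
  apply: (leq_trans x2); rewrite /step /set_coord !inE.
  by case: (eqVneq j d) => [->|_] //=; rewrite dA addn0 addn1.
by exists p, q; split => //; exact: W.
Qed.

Section Box.
Variable m : nat.

(** The directions are kept in a list so that any of them can be brought innermost, where it
    telescopes. *)
Fixpoint box_sum s F z : 'F_2 :=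
  if s is d :: s' then \sum_(0 <= j < m) box_sum s' F (set_coord z d j)
  else F z.

Lemma eq_box_sum s F G z : F =1 G -> box_sum s F z = box_sum s G z.
Proof.
by move=> FG; elim: s z => [|d s IH] z //=; apply: eq_bigr => j _; exact: IH.
Qed.

Lemma box_sum0 s z : box_sum s (fun=> 0) z = 0.
Proof. by elim: s z => [|d s IH] z //=; rewrite big1. Qed.

Lemma box_sum_sum s (P : pred 'I_N) (F : 'I_N -> ('I_N -> nat) -> 'F_2) z :
  box_sum s (fun y => \sum_(d | P d) F d y) z = \sum_(d | P d) box_sum s (F d) z.
Proof.
elim: s z => [|e s IH] z //=; rewrite exchange_big /=.
by apply: eq_bigr => j _; exact: IH.
Qed.

Lemma box_sum_cat s1 s2 F z :
  box_sum (s1 ++ s2) F z = box_sum s1 (box_sum s2 F) z.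
Proof. by elim: s1 z => [|d s1 IH] z //=; apply: eq_bigr => j _; exact: IH. Qed.

Lemma box_sum_set_coord s F z d v : d \notin s ->
  box_sum s (fun y => F (set_coord y d v)) z = box_sum s F (set_coord z d v).
Proof.
elim: s z => [|e s IH] z //=; rewrite in_cons negb_or => /andP[de ds].
by apply: eq_bigr => j _; rewrite IH // set_coordC // eq_sym.
Qed.

Lemma box_sum_rot s d F z : d \notin s ->
  box_sum (d :: s) F z = box_sum (rcons s d) F z.
Proof.
move=> ds; rewrite -cats1 box_sum_cat /=.
elim: s z ds => [|e s IH] z //=; rewrite in_cons negb_or => /andP[de ds].
rewrite exchange_big /=; apply: eq_bigr => j _; rewrite -IH //=.
by apply: eq_bigr => i _; rewrite set_coordC.
Qed.

Lemma box_sum_pull s d F z : uniq s -> d \in s ->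
  box_sum s F z = box_sum (rcons (rem d s) d) F z.
Proof.
elim: s z => [//|e s IH] z /= /andP[es us]; rewrite in_cons.
case: (eqVneq d e) => [-> _|de /= ds].
  exact: box_sum_rot.
by apply: eq_bigr => j _; exact: IH.
Qed.

Lemma box_sum_neq0 s F z : box_sum s F z != 0 ->
  exists2 y, F y != 0 & (forall i, i \in s -> uniq s -> (y i < m)%N) /\
                        (forall i, i \notin s -> y i = z i).
Proof.
elim: s z => [|d s IH] z /=; first by exists z.
move=> nz; have [j jm nz'] : exists2 j, (j < m)%N &
    box_sum s F (set_coord z d j) != 0.
  apply: contrapT => nE; move: nz; rewrite big_nat_cond big1 ?eqxx// => j.
  rewrite andbT => /andP[_ jm].
  by apply/eqP; apply: contrapT => /negP E; apply: nE; exists j.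
have [y Fy [y1 y2]] := IH _ nz'; exists y => //; split=> i.
  rewrite in_cons => /predU1P[-> /andP[ds _]|si /andP[_ us]]; last exact: y1.
  by rewrite y2 // /set_coord eqxx.
rewrite in_cons negb_or => /andP[id si].
by rewrite y2 // /set_coord (negbTE id).
Qed.

Hypothesis a0 : forall i z, z i = 0%N -> a i z = 0.
Hypothesis a1 : forall i z, z i = m -> a i z = 1.

(** No step leaves the face, and [a d] is constant there, so the factor for [d] vanishes on every
    path. *)
Lemma cup_face s A d z : d \in s -> d \notin A -> z d = 0%N \/ z d = m ->
  cup s A z = 0.
Proof.
elim: s A z => [//|b s IH] A z; rewrite in_cons => sd dA zd /=.
have stepd c : c \in A -> step z c d = z d.
  rewrite /step /set_coord; case: (eqVneq d c) => // <-.
  by rewrite (negbTE dA).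
apply: big1 => c cA; case/predU1P: sd => [<-|ds].
  have -> : a d (step z c) = a d z.
    by case: zd => zd; [rewrite !a0 ?stepd|rewrite !a1 ?stepd].
  by rewrite addrr_F2 mul0r.
rewrite IH ?mulr0 // ?stepd // inE negb_and dA orbT //.
Qed.

(* Stokes: [cup_exact] makes the sum telescope to the faces of the box, and
   only the face [z i = m] of the first direction survives. *)
Lemma box_sum_cup s z : uniq s -> box_sum s (cup s [set j in s]) z = 1.
Proof.
elim: s z => [//|i s IH] z us; move: (us) => /= /andP[is_ uss].
rewrite -/(box_sum (i :: s) _ _) (eq_box_sum _ _ _ _ (cup_exact i s _)).
rewrite box_sum_sum.
set A := [set j in i :: s].
have pull d : d \in A ->
    box_sum (i :: s) (fun y => a i (step y d) * cup s (A :\ d) (step y d) +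
                      a i y * cup s (A :\ d) y) z =
    box_sum (rem d (i :: s)) (fun y =>
      a i (set_coord y d m) * cup s (A :\ d) (set_coord y d m) +
      a i (set_coord y d 0) * cup s (A :\ d) (set_coord y d 0)) z.
  rewrite inE => ds; rewrite (box_sum_pull _ d) // -cats1 box_sum_cat.
  apply: eq_box_sum => y /=.
  rewrite -[X in _ + X]oppr_F2 -(telescope_sumr (fun j =>
    a i (set_coord y d j) * cup s (A :\ d) (set_coord y d j))) //.
  by apply: eq_bigr => j _; rewrite step_set_coord oppr_F2.
rewrite (eq_bigr _ pull) (bigD1 i) /=; last by rewrite !inE eqxx.
rewrite eqxx [X in _ + X]big1 ?addr0.
  rewrite -[RHS](IH (set_coord z i m) uss) -box_sum_set_coord //.
  apply: eq_box_sum => y; rewrite a1 ?a0 /set_coord ?eqxx // mul1r mul0r addr0.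
  congr cup; apply/setP => j; rewrite !inE.
  by case: (eqVneq j i) => [->|//]; rewrite (negbTE is_).
move=> d /andP[dA di]; move: dA; rewrite !inE (negbTE di) /= => ds.
rewrite eq_sym (negbTE di) -[RHS](box_sum0 (i :: rem d s) z).
apply: eq_box_sum => y; rewrite !(cup_face _ _ d) ?mulr0 ?addr0 //.
- by rewrite !inE eqxx.
- by left; rewrite /set_coord eqxx.
- by rewrite !inE eqxx.
- by right; rewrite /set_coord eqxx.
Qed.

End Box.
End CubicalSperner.

(** With the labels read in ['F_2] the box sum is 1, so some cell has a nonzero coefficient, and in
    it every label takes both values. *)
Lemma cubical_sperner (N m : nat) (b : 'I_N -> ('I_N -> nat) -> bool) :
  (forall i z, z i = 0%N -> ~~ b i z) -> (forall i z, z i = m -> b i z) ->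
  exists2 z : 'I_N -> nat, forall i, (z i < m)%N &
    forall i, exists p q : 'I_N -> nat,
      [/\ forall j, (z j <= p j <= (z j).+1)%N,
          forall j, (z j <= q j <= (z j).+1)%N, ~~ b i p & b i q].
Proof.
move=> b0 b1; pose a i z : 'F_2 := (b i z)%:R.
have a0 i z : z i = 0%N -> a i z = 0 by move=> /b0; rewrite /a; case: (b i z).
have a1 i z : z i = m -> a i z = 1 by move=> /b1; rewrite /a => ->.
have := box_sum_cup _ _ _ a0 a1 (enum 'I_N) (fun=> 0%N) (enum_uniq _).
set A := [set j in _] => S1.
have /box_sum_neq0[z cz [zm _]] :
    box_sum _ m (enum 'I_N) (cup _ a (enum 'I_N) A) (fun=> 0%N) != 0.
  by rewrite S1 oner_eq0.
exists z => [i|i]; first by apply: zm; [rewrite mem_enum|exact: enum_uniq].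
have [|p [q [zp zq pq]]] := cup_neq0 _ _ _ _ _ cz i; first by rewrite mem_enum.
have cell x : (forall j, (z j <= x j <= z j + (j \in A))%N) ->
    forall j, (z j <= x j <= (z j).+1)%N.
  move=> xP j; have /andP[-> /= x2] := xP j; apply: (leq_trans x2).
  by rewrite -addn1 leq_add2l leq_b1.
move: pq; rewrite /a; case bp: (b i p); case bq: (b i q); rewrite ?eqxx // => _.
  by exists q, p; split; rewrite ?bp ?bq //; exact: cell.
by exists p, q; split; rewrite ?bp ?bq //; exact: cell.
Qed.

(** * Limits along a free ultrafilter, and uniform continuity on compact sets *)

Section Ultralimits.
Variables (R : realType) (U : set_system nat).
Hypothesis UU : UltraFilter U.
Hypothesis ooU : \oo `<=` U.

(** Compactness gives a cluster point of the image ultrafilter; a neighbourhood outside that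
    ultrafilter would have its complement inside, against clustering. *)
Lemma ultralimit_compact (T : topologicalType) (A : set T) (x : nat -> T) :
  compact A -> (forall n, A (x n)) -> exists2 l, A l & x @ U --> l.
Proof.
move=> cA xA; have UP := @ultra_proper _ _ UU.
have xU : (x @ U) A by apply: (@filterE _ U).
have [l [lA cl]] := cA (x @ U) (fmap_proper_filter x UP) xU.
exists l => // V lV; have [//|xV] := in_ultra_setVsetC (x @^-1` V) UU.
have [y [] /=] := cl (~` V) V xV lV; tauto.
Qed.

Lemma ultralimit (a b : R) (x : nat -> R) : (forall n, a <= x n <= b) ->
  exists2 l, a <= l <= b & x @ U --> l.
Proof.
move=> xab; have [||l lab xl] := @ultralimit_compact _ `[a, b]%classic x.
- exact: segment_compact.
- by move=> n; rewrite /= in_itv; exact: xab.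
- by exists l; first by move: lab; rewrite /= in_itv.
Qed.

Lemma near_natSinv_lt (e : R) : 0 < e -> \forall n \near U, n.+1%:R^-1 < e.
Proof. by move=> e0; apply: ooU; exact: (near_infty_natSinv_lt (PosNum e0)). Qed.

End Ultralimits.

(** One such [U] gives limits to all bounded sequences at once, in place of diagonal extraction of
    subsequences. *)
Lemma free_ultrafilter : exists2 U : set_system nat, UltraFilter U & \oo `<=` U.
Proof. by have [U [UU ooU]] := @ultraFilterLemma _ \oo _; exists U. Qed.

(** Heine's theorem: pairs closer than [1/(n+1)] with values [e] apart would accumulate at one point
    of [A], against continuity there. *)
Lemma compact_uniform_continuity (R : realType) (X : pseudoMetricType R)
    (A : set X) (f : X -> R) :
  compact A -> {within A, continuous f} ->
  forall e, 0 < e -> exists2 d, 0 < d &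
    forall x y, A x -> A y -> ball x d y -> `|f x - f y| < e.
Proof.
move=> cA /subspace_continuousP cf e e0; apply: contrapT => nd.
have /choice[w wP] : forall n : nat, exists xy : X * X,
    [/\ A xy.1, A xy.2, ball xy.1 n.+1%:R^-1 xy.2 & e <= `|f xy.1 - f xy.2|].
  move=> n; apply: contrapT => nw; apply: nd; exists n.+1%:R^-1.
    by rewrite invr_gt0.
  move=> x y Ax Ay xy; rewrite ltNge; apply/negP => exy.
  by apply: nw; exists (x, y).
have [U UU ooU] := free_ultrafilter; have UP := @ultra_proper _ _ UU.
have [|p Ap xp] := @ultralimit_compact _ UU _ _ (fst \o w) cA.
  by move=> n; have [] := wP n.
have e20 : 0 < e / 2 by apply: divr_gt0.
have := cf p Ap => /cvgrPdist_lt/(_ _ e20); rewrite near_withinE.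
move=> /nbhs_ballP[d /= d0 dP].
have d20 : 0 < d / 2 by apply: divr_gt0.
have Ux : \forall n \near U, ball p (d / 2) (w n).1.
  exact: (xp (ball p (d / 2)) (nbhsx_ballx p _ d20)).
have Un := @near_natSinv_lt R U ooU _ d20.
have [n [xn nd2]] : exists n, ball p (d / 2) (w n).1 /\ n.+1%:R^-1 < d / 2.
  by have [n] := filter_ex (filterI Ux Un); exists n.
have [Ax Ay xy] := wP n; apply/negP; rewrite -ltNge [ltRHS]splitr.
apply: le_lt_trans (ler_distD (f p) _ _) _; apply: ltrD.
  rewrite distrC; apply: dP => //; apply: le_ball xn.
  by rewrite [leRHS]splitr lerDl ltW.
apply: dP => //; rewrite [d]splitr; apply: ball_triangle xn _.
by apply: le_ball xy; exact: ltW.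
Qed.

(** * Brouwer's fixed point theorem on a cube *)

Section Brouwer.
Variables (R : realType) (N : nat) (r : R).
Hypothesis r0 : 0 < r.

Definition cube (x : 'I_N -> R) := forall i, `|x i| <= r.

(** The affine map from the grid with coordinates 0 to [n+1] to the cube; [minn] clamps larger
    coordinates, so that every [z] lands in the cube. *)
Definition grid_point n (z : 'I_N -> nat) : 'I_N -> R :=
  fun i => r * (2 * ((minn (z i) n.+1)%:R / n.+1%:R) - 1).

Lemma cube_grid_point n z : cube (grid_point n z).
Proof.
move=> i; rewrite /grid_point normrM gtr0_norm // -[leRHS]mulr1 ler_pM2l //.
set q := _ / _.
have q0 : 0 <= q by apply: divr_ge0.
have q1 : q <= 1 by rewrite ler_pdivrMr // mul1r ler_nat geq_minr.
by rewrite ler_norml; apply/andP; split; lra.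
Qed.

Lemma grid_point_near n z p j : (z j <= p j <= (z j).+1)%N ->
  `|grid_point n p j - grid_point n z j| <= 2 * r * n.+1%:R^-1.
Proof.
move=> /andP[zp pz]; rewrite /grid_point -mulrBr normrM gtr0_norm //.
rewrite (_ : 2 * _ / _ = r * (2 / n.+1%:R)); last by rewrite mulrA (mulrC r).
rewrite ler_pM2l // opprD addrACA subrr addr0 -mulrBr -mulrBl.
have h1 : (minn (z j) n.+1 <= minn (p j) n.+1)%N.
  by rewrite leq_min geq_minr andbT (leq_trans _ zp) // geq_minl.
have h2 : (minn (p j) n.+1 <= (minn (z j) n.+1).+1)%N.
  rewrite -minnSS leq_min (leq_trans _ pz) ?geq_minl //=.
  by rewrite (leq_trans (geq_minr _ _)).
rewrite -natrB // ger0_norm; last by rewrite !mulr_ge0 // invr_ge0.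
rewrite ler_pM2l // ler_piMl ?invr_ge0 // -[1]/(1%:R) ler_nat.
by rewrite leq_subLR addn1.
Qed.

(** For each mesh, the Sperner lemma yields a cell where each coordinate is moved weakly up at one
    corner and weakly down at another. The cells shrink along [U] to a point, which is fixed by
    continuity. *)
Theorem brouwer_cube (g : ('I_N -> R) -> 'I_N -> R) :
  (forall x, cube x -> cube (g x)) ->
  (forall x, cube x -> forall e, 0 < e -> exists2 d, 0 < d &
     forall y, cube y -> (forall i, `|x i - y i| < d) ->
       forall i, `|g x i - g y i| < e) ->
  exists2 x, cube x & g x =1 x.
Proof.
move=> gQ gc.
(* The conjunct [0 < z i] forces label 0 on the lower face even where [g] fixes that coordinate; on
   the upper face [g <= r] gives label 1. *)
pose b n (i : 'I_N) z :=
  (0 < z i)%N && (g (grid_point n z) i <= grid_point n z i).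
have Z n : exists w : ('I_N -> nat) * ('I_N -> ('I_N -> nat) * ('I_N -> nat)),
    forall i, [/\ forall j, (w.1 j <= (w.2 i).1 j <= (w.1 j).+1)%N,
      forall j, (w.1 j <= (w.2 i).2 j <= (w.1 j).+1)%N,
      ~~ b n i (w.2 i).1 & b n i (w.2 i).2].
  have [||z _ zpq] := @cubical_sperner N n.+1 (b n).
  - by move=> i z; rewrite /b => ->.
  - move=> i z zi; rewrite /b zi /=.
    have -> : grid_point n z i = r.
      by rewrite /grid_point zi minnn divff ?pnatr_eq0 // mulr1 addrK mulr1.
    exact: le_trans (ler_norm _) (gQ _ (cube_grid_point n z) i).
  have /choice[w wP] : forall i, exists pq : ('I_N -> nat) * ('I_N -> nat),
      [/\ forall j, (z j <= pq.1 j <= (z j).+1)%N,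
          forall j, (z j <= pq.2 j <= (z j).+1)%N, ~~ b n i pq.1 & b n i pq.2].
    by move=> i; have [p [q pqP]] := zpq i; exists (p, q).
  by exists (z, w).
have {Z}[w wP] := choice Z.
have [U UU ooU] := free_ultrafilter.
have UP := @ultra_proper _ _ UU.
have /choice[x xP] : forall i, exists l, `|l| <= r /\
    (fun n => grid_point n (w n).1 i) @ U --> l.
  move=> i; have [|l lr lP] := @ultralimit R U UU (- r) r
      (fun n => grid_point n (w n).1 i).
    by move=> n; rewrite -ler_norml; exact: cube_grid_point.
  by exists l; rewrite ler_norml.
exists x => [i|i]; first by have [] := xP i.
have Qx : cube x by move=> j; have [] := xP j.
have approx e : 0 < e -> `|g x i - x i| <= e.
  move=> e0; have e20 : 0 < e / 2 by apply: divr_gt0.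
  have [d d0 dP] := gc x Qx _ e20.
  (* Half of [h] is for the distance from [x] to the base corner of the cell, half for the width of
     the cell. *)
  pose h := Num.min d (e / 2).
  have h0 : 0 < h by rewrite lt_min d0 e20.
  have h20 : 0 < h / 2 by apply: divr_gt0.
  have [n [xn nh]] : exists n, (forall j, `|x j - grid_point n (w n).1 j| < h / 2)
      /\ 2 * r * n.+1%:R^-1 < h / 2.
    suff : \forall n \near U,
        (forall j, `|x j - grid_point n (w n).1 j| < h / 2) /\
        2 * r * n.+1%:R^-1 < h / 2 by exact: filter_ex.
    have Ux : \forall n \near U, forall j, `|x j - grid_point n (w n).1 j| < h / 2.
      apply: filter_forall => j; have [_ xj] := xP j.
      by move: xj => /cvgrPdist_lt/(_ _ h20).
    have r2 : 0 < 2 * r by apply: mulr_gt0.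
    have Un := @near_natSinv_lt R U ooU _ (divr_gt0 h20 r2).
    near=> n; split; first by near: n.
    rewrite mulrC -ltr_pdivlMr //; near: n; exact: Un.
  have close p : (forall j, ((w n).1 j <= p j <= ((w n).1 j).+1)%N) ->
      forall j, `|x j - grid_point n p j| < h.
    move=> pP j; apply: le_lt_trans (ler_distD (grid_point n (w n).1 j) _ _) _.
    rewrite [ltRHS]splitr ltrD // (distrC (grid_point n (w n).1 j)).
    exact: le_lt_trans (grid_point_near n _ _ _ (pP j)) nh.
  have [hd he] : h <= d /\ h <= e / 2 by split; rewrite ge_min lexx ?orbT.
  have val p : (forall j, ((w n).1 j <= p j <= ((w n).1 j).+1)%N) ->
      `|x i - grid_point n p i| < e / 2 /\
      `|g x i - g (grid_point n p) i| < e / 2.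
    move=> pP; split; first exact: lt_le_trans (close p pP i) he.
    apply: dP; first exact: cube_grid_point.
    by move=> j; exact: lt_le_trans (close p pP j) hd.
  have [/val[p1 p2] /val[q1 q2] bp /andP[_ bq]] := wP n i.
  (* A corner labelled 0 either has [i]-th coordinate [- r], which [g] cannot lower, or satisfies
     the strict opposite inequality. *)
  have gp : grid_point n ((w n).2 i).1 i <= g (grid_point n ((w n).2 i).1) i.
    move: bp; rewrite /b negb_and -leqNgt leqn0 => /orP[/eqP z0|].
      rewrite {1}/grid_point z0 min0n mul0r mulr0 sub0r mulrN1.
      have := gQ _ (cube_grid_point n ((w n).2 i).1) i.
      by rewrite ler_norml => /andP[].
    by rewrite -ltNge => /ltW.
  move: p1 p2 q1 q2; rewrite !ltr_norml ler_norml => /andP[? ?] /andP[? ?].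
  by move=> /andP[? ?] /andP[? ?]; apply/andP; split; lra.
apply/eqP; rewrite -subr_eq0 -normr_le0.
by apply/ler_addgt0Pr => e e0; rewrite add0r; exact: approx.
Unshelve. all: by end_near.
Qed.

End Brouwer.

(** * Continuous functions on the unit interval and their sup norm *)

Section C01Theory.
Variable R : realType.
Implicit Types (u v : R -> R) (t : R).

Lemma C01P u : C01 u <-> forall t, t \in `[0, 1] -> forall e, 0 < e ->
  exists2 d, 0 < d & forall s, s \in `[0, 1] -> `|t - s| < d -> `|u t - u s| < e.
Proof.
rewrite /C01 subspace_continuousP; split=> cu t t01.
  move=> e e0; have /cvgrPdist_lt/(_ _ e0) := cu t t01.
  rewrite near_withinE => /nbhs_ballP[d /= d0 dP]; exists d => // s s01 ts.
  exact: dP.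
apply/cvgrPdist_lt => e e0; rewrite near_withinE; apply/nbhs_ballP.
by have [d d0 dP] := cu t t01 e e0; exists d => // s ts s01; exact: dP.
Qed.

Lemma C01_bounded u : C01 u -> exists2 M, 0 < M &
  forall t, t \in `[0, 1] -> `|u t| <= M.
Proof.
move=> cu; have cnu : {within `[0, 1], continuous (fun t => `|u t|)}.
  apply/C01P => t t01 e e0; have [d d0 dP] := (C01P u).1 cu t t01 e e0.
  exists d => // s s01 ts; apply: le_lt_trans (dP s s01 ts).
  exact: ler_dist_dist.
have [c c01 cP] := EVT_max (@ler01 R) cnu.
exists (`|u c| + 1); first by rewrite ltr_wpDl.
by move=> t t01; rewrite (le_trans (cP t t01)) // lerDl.
Qed.

Lemma supnorm_ub u t : C01 u -> t \in `[0, 1] -> `|u t| <= supnorm u.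
Proof.
move=> cu t01; have [M _ MP] := C01_bounded u cu.
apply: sup_ubound; last by exists t.
by exists M => _ [s s01 <-]; exact: MP.
Qed.

Lemma supnorm_le u M : (forall t, t \in `[0, 1] -> `|u t| <= M) -> supnorm u <= M.
Proof.
move=> uM; apply: ge_sup => [|_ [t t01 <-]]; last exact: uM.
by exists `|u 0|, 0 => //=; rewrite in_itv /= lexx ler01.
Qed.

End C01Theory.

(** * Interpolation at equally spaced nodes *)

Section Interpolation.
Variables (R : realType) (n : nat).
Implicit Types (c : 'I_n.+2 -> R) (t : R).

Definition node (i : 'I_n.+2) : R := i%:R / n.+1%:R.

Definition hat (i : 'I_n.+2) t : R := Num.max 0 (1 - n.+1%:R * `|t - node i|).

(** Dividing by the sum of the tent functions makes the weights add up to 1 by construction wherever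
    that sum is nonzero. *)
Definition interp c t : R := (\sum_i c i * hat i t) / \sum_i hat i t.

Lemma node01 i : node i \in `[0, 1].
Proof.
rewrite in_itv /= /node divr_ge0 //= ler_pdivrMr // mul1r ler_nat.
by rewrite -ltnS.
Qed.

Lemma hat_ge0 i t : 0 <= hat i t.
Proof. by rewrite /hat le_max lexx. Qed.

Lemma hat_gt0 i t : (0 < hat i t) = (`|t - node i| < n.+1%:R^-1).
Proof.
rewrite /hat lt_max ltxx /= subr_gt0 mulrC -ltr_pdivlMr //.
by rewrite mul1r.
Qed.

Lemma near_node t : t \in `[0, 1] -> exists i, `|t - node i| < n.+1%:R^-1.
Proof.
rewrite in_itv /= => /andP[t0 t1].
have tn0 : 0 <= t * n.+1%:R by rewrite mulr_ge0.
have /andP[l1 l2] := truncn_itv tn0.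
have kn : (Num.truncn (t * n.+1%:R) < n.+2)%N.
  rewrite ltnS -(ler_nat R); apply: le_trans l1 _.
  by rewrite ler_piMl.
(* The node just below [t]; at [t = 1] it is the last one, of index [n+1]. *)
exists (Ordinal kn); rewrite /node /=.
rewrite -[t in t - _](@mulfK _ n.+1%:R) ?pnatr_eq0 // -mulrBl.
rewrite ger0_norm ?mulr_ge0 ?subr_ge0 ?invr_ge0 // ltr_pdivrMr //.
by rewrite mulVf ?pnatr_eq0 // ltrBlDl natr1.
Qed.

Lemma sum_hat_gt0 t : t \in `[0, 1] -> 0 < \sum_i hat i t.
Proof.
move=> /near_node[i]; rewrite -hat_gt0 => hi.
rewrite (bigD1 i) //= ltr_pwDl // sumr_ge0 // => j _; exact: hat_ge0.
Qed.

(** [interp c t] is a convex combination of the values at the nodes within [1/(n+1)] of [t]. This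
    yields both the norm bound and the approximation error. *)
Lemma interp_le c t e : t \in `[0, 1] ->
  (forall i, `|t - node i| < n.+1%:R^-1 -> `|c i| <= e) -> `|interp c t| <= e.
Proof.
move=> t01 ce; have S0 := sum_hat_gt0 t t01.
rewrite /interp normrM normfV (gtr0_norm S0) ler_pdivrMr // mulr_sumr.
apply: le_trans (ler_norm_sum _ _ _) _; apply: ler_sum => i _.
rewrite normrM (ger0_norm (hat_ge0 i t)).
have := hat_ge0 i t; rewrite le_eqVlt => /predU1P[<-|hi].
  by rewrite !mulr0.
by rewrite ler_pM2r // ce // -hat_gt0.
Qed.

Lemma interpB c c' t :
  interp c t - interp c' t = interp (fun i => c i - c' i) t.
Proof.
rewrite /interp -mulrBl -sumrB; congr (_ / _).
by apply: eq_bigr => i _; rewrite mulrBl.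
Qed.

Lemma interp_cst x t : t \in `[0, 1] -> interp (fun=> x) t = x.
Proof.
move=> t01; rewrite /interp -mulr_sumr mulfK //.
by rewrite gt_eqF // sum_hat_gt0.
Qed.

Lemma C01_interp c : C01 (interp c).
Proof.
apply/subspace_continuousP => t t01; apply: cvg_within_filter.
have ch i : hat i s @[s --> t] --> hat i t.
  rewrite /hat.
  apply: (@continuous_max _ _ (cst 0) (fun s => 1 - n.+1%:R * `|s - node i|)).
    exact: cvg_cst.
  apply: cvgB; first exact: cvg_cst.
  apply: cvgM; first exact: cvg_cst.
  by apply: cvg_norm; apply: cvgB; [exact: cvg_id|exact: cvg_cst].
apply: cvgM.
  apply: cvg_big => [|i _]; first exact: add_continuous.
  by apply: cvgM; [exact: cvg_cst|exact: ch].
apply: cvgV; first by rewrite gt_eqF // sum_hat_gt0.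
by apply: cvg_big => [|i _]; [exact: add_continuous|exact: ch].
Qed.

End Interpolation.

(** * Fixed points and eigenvectors of operators on a ball of C([0,1]) *)

Definition C01_ball {R : realType} (rho : R) (u : R -> R) : Prop :=
  C01 u /\ forall t, t \in `[0, 1] -> `|u t| <= rho.

(** Compactness of the image enters as equicontinuity. Brouwer gives approximate fixed points [u n];
    the pointwise ultralimit [w] of [G (u n)] is uniform by equicontinuity, so [u n] tends to [w]
    too and continuity at [w] concludes. *)
Theorem schauder_C01 (R : realType) (rho : R) (G : (R -> R) -> R -> R) :
  0 < rho ->
  (forall u, C01_ball rho u -> forall t, t \in `[0, 1] -> `|G u t| <= rho) ->
  (forall e, 0 < e -> exists2 d, 0 < d & forall u, C01_ball rho u ->
     forall t s, t \in `[0, 1] -> s \in `[0, 1] -> `|t - s| < d ->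
       `|G u t - G u s| < e) ->
  (forall u, C01_ball rho u -> forall e, 0 < e -> exists2 d, 0 < d &
     forall v, C01_ball rho v ->
       (forall t, t \in `[0, 1] -> `|u t - v t| <= d) ->
       forall t, t \in `[0, 1] -> `|G u t - G v t| < e) ->
  exists2 u, C01_ball rho u & forall t, t \in `[0, 1] -> u t = G u t.
Proof.
move=> rho0 Gb Gec Gc.
have interp_ball n (c : 'I_n.+2 -> R) :
    cube R n.+2 rho c -> C01_ball rho (interp R n c).
  move=> cQ; split; first exact: C01_interp.
  by move=> t t01; apply: interp_le => // i _; exact: cQ.
(* [u n] interpolates a Brouwer fixed point of the map on node values, so it differs from [G (u n)]
   by at most the oscillation of the latter at scale [1/(n+1)]. *)
have /choice[u uP] : forall n : nat, exists u, C01_ball rho u /\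
    forall t e, t \in `[0, 1] ->
      (forall s, s \in `[0, 1] -> `|t - s| < n.+1%:R^-1 -> `|G u t - G u s| <= e) ->
      `|u t - G u t| <= e.
  move=> n; have [||c cQ cP] := @brouwer_cube R n.+2 rho rho0
    (fun c i => G (interp R n c) (node R n i)).
  - by move=> c cQ i; apply: Gb; [exact: interp_ball|exact: node01].
  - move=> c cQ e e0; have [d d0 dP] := Gc _ (interp_ball _ _ cQ) e e0.
    exists d => // c' cQ' cc' i; apply: dP; last exact: node01.
      exact: interp_ball.
    move=> t t01; rewrite interpB; apply: interp_le => // j _.
    exact/ltW/cc'.
  exists (interp R n c); split; first exact: interp_ball.
  move=> t e t01 tP; rewrite -[X in _ - X](interp_cst R n _ t t01) interpB.
  apply: interp_le => // i ti; rewrite -cP distrC; apply: tP => //.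
  exact: node01.
have [U UU ooU] := free_ultrafilter; have UP := @ultra_proper _ _ UU.
have /choice[w wP] : forall t, exists l, t \in `[0, 1] ->
    `|l| <= rho /\ (fun n => G (u n) t) @ U --> l.
  move=> t; have [t01|nt] := boolP (t \in `[0, 1]); last by exists 0.
  have [|l lr lP] := @ultralimit R U UU (- rho) rho (fun n => G (u n) t).
    by move=> n; rewrite -ler_norml; apply: Gb => //; have [] := uP n.
  by exists l; rewrite ler_norml.
have wlim t e : t \in `[0, 1] -> 0 < e ->
    \forall n \near U, `|w t - G (u n) t| < e.
  by move=> t01 e0; have [_ /cvgrPdist_lt/(_ _ e0)] := wP t t01.
(* The common modulus of continuity passes to the limit [w], the strict bound becoming a weak
   one. *)
have wec e : 0 < e -> exists2 d, 0 < d & (forall u, C01_ball rho u ->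
     forall t s, t \in `[0, 1] -> s \in `[0, 1] -> `|t - s| < d ->
       `|G u t - G u s| < e) /\
     forall t s, t \in `[0, 1] -> s \in `[0, 1] -> `|t - s| < d ->
       `|w t - w s| <= e.
  move=> e0; have [d d0 dP] := Gec e e0; exists d => //; split=> // t s t01 s01 ts.
  apply/ler_addgt0Pr => h h0; have h20 : 0 < h / 2 by apply: divr_gt0.
  have [n [tn sn]] := filter_ex (filterI (wlim t _ t01 h20) (wlim s _ s01 h20)).
  have [un _] := uP n; have := dP _ un t s t01 s01 ts.
  move: tn sn; rewrite /= !ltr_norml ler_norml => /andP[? ?] /andP[? ?] /andP[? ?].
  by apply/andP; split; lra.
have wb : C01_ball rho w.
  split; last by move=> t t01; have [] := wP t t01.
  apply/C01P => t t01 e e0; have e20 : 0 < e / 2 by apply: divr_gt0.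
  have [d d0 [_ dP]] := wec _ e20; exists d => // s s01 ts.
  by apply: le_lt_trans (dP t s t01 s01 ts) _; lra.
(* Convergence at the finitely many nodes of a mesh finer than [d] is simultaneous along [U];
   equicontinuity carries it to all [t], with [e / 3] for each of three gaps. *)
have wunif e : 0 < e ->
    \forall n \near U, forall t, t \in `[0, 1] -> `|w t - G (u n) t| <= e.
  move=> e0; have e30 : 0 < e / 3 by apply: divr_gt0.
  have [d d0 [dP wd]] := wec _ e30.
  have [m md] := filter_ex (@near_natSinv_lt R U ooU _ d0).
  have Um : \forall n \near U, forall i : 'I_m.+2,
      `|w (node R m i) - G (u n) (node R m i)| < e / 3.
    by apply: filter_forall => i; apply: wlim => //; exact: node01.
  apply: filterS Um => n nP t t01.
  have [i /lt_trans/(_ md) ti] := near_node R m t t01.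
  have := wd _ _ t01 (node01 R m i) ti.
  have [un _] := uP n; have := dP _ un _ _ t01 (node01 R m i) ti.
  have := nP i; rewrite !ltr_norml !ler_norml.
  by move=> /andP[? ?] /andP[? ?] /andP[? ?]; apply/andP; split; lra.
exists w => // t t01; apply/eqP; rewrite -subr_eq0 -normr_le0.
apply/ler_addgt0Pr => e e0; rewrite add0r.
have e20 : 0 < e / 2 by apply: divr_gt0.
have [d d0 dP] := Gc w wb _ e20.
have h0 : 0 < Num.min (d / 2) (e / 2) by rewrite lt_min !divr_gt0.
have [d' d'0 d'P] := Gec _ h0.
have [n [nd' nw]] :=
  filter_ex (filterI (@near_natSinv_lt R U ooU _ d'0) (wunif _ h0)).
have [un unP] := uP n.
have unw s : s \in `[0, 1] -> `|u n s - G (u n) s| <= Num.min (d / 2) (e / 2).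
  move=> s01; apply: unP => // s' s'01 ss'.
  by apply/ltW/d'P => //; exact: lt_trans nd'.
have := dP _ un _ t t01.
have : forall s, s \in `[0, 1] -> `|w s - u n s| <= d.
  move=> s s01; apply: le_trans (ler_distD (G (u n) s) _ _) _.
  rewrite [leRHS]splitr; apply: lerD.
    by apply: le_trans (nw s s01) _; rewrite ge_min lexx.
  by rewrite distrC; apply: le_trans (unw s s01) _; rewrite ge_min lexx.
move=> /[swap] /[apply].
have : `|w t - G (u n) t| <= e / 2.
  by apply: le_trans (nw t t01) _; rewrite ge_min lexx orbT.
rewrite ltr_norml !ler_norml => /andP[? ?] /andP[? ?].
by apply/andP; split; lra.
Qed.

(** Schauder's theorem applies to [T u] rescaled to norm [rho] with sign [sg]; the lower bound [c]
    keeps the rescaling continuous and the image equicontinuous. *)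
Theorem birkhoff_kellogg_C01 (R : realType) (rho c sg : R)
    (T : (R -> R) -> R -> R) :
  0 < rho -> 0 < c -> `|sg| = 1 ->
  (forall e, 0 < e -> exists2 d, 0 < d & forall u, C01_ball rho u ->
     forall t s, t \in `[0, 1] -> s \in `[0, 1] -> `|t - s| < d ->
       `|T u t - T u s| < e) ->
  (forall u, C01_ball rho u -> forall e, 0 < e -> exists2 d, 0 < d &
     forall v, C01_ball rho v ->
       (forall t, t \in `[0, 1] -> `|u t - v t| <= d) ->
       forall t, t \in `[0, 1] -> `|T u t - T v t| <= e) ->
  (forall u, C01_ball rho u -> c <= supnorm (T u)) ->
  exists l u, [/\ 0 < l, C01 u, supnorm u = rho &
    forall t, t \in `[0, 1] -> u t = sg * l * T u t].
Proof.
move=> rho0 c0 sg1 Tec Tc Tlow.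
have CT u : C01_ball rho u -> C01 (T u).
  move=> ub; apply/C01P => t t01 e e0; have [d d0 dP] := Tec e e0.
  by exists d => // s s01; exact: dP.
pose N u := supnorm (T u).
have N0 u : C01_ball rho u -> 0 < N u.
  by move=> ub; apply: lt_le_trans (Tlow u ub).
have TN u t : C01_ball rho u -> t \in `[0, 1] -> `|T u t| / N u <= 1.
  move=> ub t01; rewrite ler_pdivrMr ?N0 // mul1r.
  by apply: supnorm_ub => //; exact: CT.
pose G u t := sg * (rho / N u) * T u t.
have normG x y z : `|sg * (x / y) * z| = `|x| * (`|z| / `|y|).
  by rewrite !normrM sg1 mul1r normfV -mulrA (mulrC _^-1).
have [|||u ub uG] := schauder_C01 R rho G rho0.
- move=> u ub t t01; rewrite /G normG (gtr0_norm rho0) (gtr0_norm (N0 u ub)).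
  by apply: ler_piMr; [exact: ltW|exact: TN].
(* The rescaling factor [rho / N u] is at most [rho / c]. *)
- move=> e e0; have e1 : 0 < e * c / rho by rewrite divr_gt0 // mulr_gt0.
  have [d d0 dP] := Tec _ e1; exists d => // u ub t s t01 s01 ts.
  rewrite /G -mulrBr normG (gtr0_norm rho0) (gtr0_norm (N0 u ub)).
  rewrite mulrC -ltr_pdivlMr // ltr_pdivrMr ?N0 //.
  apply: lt_le_trans (dP u ub t s t01 s01 ts) _.
  by rewrite mulrAC ler_pM2l ?divr_gt0 //; exact: Tlow.
- move=> u ub e e0.
  (* Two error terms arise, from the numerator and from the norm, each at most [e / 3] after
     scaling; the remaining third makes the bound strict. *)
  have e1 : 0 < e * c / (3 * rho) by rewrite divr_gt0 // mulr_gt0.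
  have [d d0 dP] := Tc u ub _ e1; exists d => // v vb uv t t01.
  have Tuv := dP v vb uv.
  have Nuv : `|N u - N v| <= e * c / (3 * rho).
    rewrite ler_distl; apply/andP; split.
      rewrite lerBlDr; apply: supnorm_le => s s01.
      rewrite -[T v s](subrK (T u s)) addrC; apply: le_trans (ler_normD _ _) _.
      apply: lerD; last by rewrite distrC; exact: Tuv.
      by apply: supnorm_ub => //; exact: CT.
    apply: supnorm_le => s s01.
    rewrite -[T u s](subrK (T v s)) addrC; apply: le_trans (ler_normD _ _) _.
    by apply: lerD; [apply: supnorm_ub => //; exact: CT|exact: Tuv].
  have -> : G u t - G v t = sg * rho * ((T u t - T v t) / N u +
      (N v - N u) / N u * (T v t / N v)).
    rewrite /G; have := lt0r_neq0 (N0 u ub); have := lt0r_neq0 (N0 v vb).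
    move: (N u) (N v) (T u t) (T v t) => x y z w y0 x0; field.
    by rewrite x0 y0.
  rewrite !normrM sg1 mul1r (gtr0_norm rho0) mulrC -ltr_pdivlMr //.
  apply: (@le_lt_trans _ _ (e / (3 * rho) + e / (3 * rho))).
    have eN x : x <= e * c / (3 * rho) -> x / N u <= e / (3 * rho).
      move=> xe; rewrite ler_pdivrMr ?N0 //; apply: le_trans xe _.
      rewrite mulrAC ler_pM2l ?Tlow // divr_gt0 // mulr_gt0 //.
    apply: le_trans (ler_normD _ _) _; apply: lerD.
      by rewrite normrM normfV (gtr0_norm (N0 u ub)) eN // Tuv.
    rewrite normrM [X in X * _]normrM normfV (gtr0_norm (N0 u ub)).
    rewrite [X in _ * X]normrM normfV (gtr0_norm (N0 v vb)).
    rewrite -[leRHS]mulr1; apply: ler_pM => //.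
    - by rewrite divr_ge0 // ltW // N0.
    - by rewrite divr_ge0 // ltW // N0.
    - by rewrite eN // distrC.
    - exact: TN.
  have -> : e / (3 * rho) = e / rho / 3 by rewrite invfM mulrA mulrAC.
  have : 0 < e / rho by apply: divr_gt0.
  lra.
exists (rho / N u), u; split=> //.
- by rewrite divr_gt0 // N0.
- by have [] := ub.
have [Cu ur] := ub.
apply/le_anti/andP; split; first exact: supnorm_le.
(* The fixed point equation gives [|T u t| = |u t| * (N u / rho)]; taking suprema and cancelling
   [N u > 0] yields [rho <= supnorm u]. *)
have : N u <= supnorm u * (N u / rho).
  apply: supnorm_le => t t01.
  have -> : `|T u t| = `|u t| * (N u / rho).
    rewrite uG // /G normG (gtr0_norm rho0) (gtr0_norm (N0 u ub)).
    have := lt0r_neq0 (N0 u ub); have := lt0r_neq0 rho0.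
    by move: (N u) `|T u t| => x y ? ?; field; apply/andP.
  by rewrite ler_pM2r ?supnorm_ub // divr_gt0 // N0.
by rewrite mulrCA -ler_pdivrMl ?N0 // mulVf ?gt_eqF ?N0 // ler_pdivlMr // mul1r.
Qed.

(** * Integrals of continuous functions over the unit interval *)

Section Integral01.
Variable R : realType.
Implicit Types g h : R -> R.

Lemma C01M g h : C01 g -> C01 h -> C01 (fun s => g s * h s).
Proof.
move=> /subspace_continuousP cg /subspace_continuousP ch.
apply/subspace_continuousP => t t01.
by apply: cvgM; [exact: cg|exact: ch].
Qed.

Lemma C01_dist g h : C01 g -> C01 h -> C01 (fun s => `|g s - h s|).
Proof.
move=> /subspace_continuousP cg /subspace_continuousP ch.
apply/subspace_continuousP => t t01.
by apply: cvg_norm; apply: cvgB; [exact: cg|exact: ch].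
Qed.

Lemma C01_integrable g : C01 g ->
  (@lebesgue_measure R).-integrable `[0, 1] (EFin \o g).
Proof. by apply: continuous_compact_integrable; exact: segment_compact. Qed.

Lemma I01_le g h : C01 g -> C01 h ->
  (forall s, s \in `[0, 1] -> g s <= h s) -> I01 g <= I01 h.
Proof. by move=> cg ch gh; apply: le_Rintegral => //; exact: C01_integrable. Qed.

Lemma I01_dist g h e : C01 g -> C01 h ->
  (forall s, s \in `[0, 1] -> `|g s - h s| <= e) -> `|I01 g - I01 h| <= e.
Proof.
move=> cg ch gh; have ig := C01_integrable g cg; have ih := C01_integrable h ch.
rewrite /I01 -RintegralB //; apply: le_trans (le_normr_Rintegral _ _) _ => //.
  apply: C01_integrable; have /subspace_continuousP cg' := cg.
  have /subspace_continuousP ch' := ch.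
  apply/subspace_continuousP => t t01.
  by apply: cvgB; [exact: cg'|exact: ch'].
have <- : \int[@lebesgue_measure R]_(s in `[(0:R), 1]) e = e.
  rewrite Rintegral_cst //= lebesgue_measure_itv /= lte_fin ltr01.
  by rewrite oppr0 adde0 mulr1.
apply: le_Rintegral => //; first by apply: C01_integrable; exact: C01_dist.
by apply: C01_integrable; apply/subspace_continuousP => t t01; exact: cvg_cst.
Qed.

End Integral01.

(** * The Hammerstein operator: compactness, continuity and bounds *)

Section HammersteinOperator.
Variables (R : realType) (rho : R).
Variables (k : R -> R -> R) (H : (R -> R) -> R) (f : R -> R -> R -> R).
Variables (Hlo Hup : R) (flo fup : R -> R).
Hypothesis k_cont : {within [set p : R * R | p.1 \in `[0, 1] /\ p.2 \in `[0, 1]],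
  continuous (fun p => k p.1 p.2)}.
Hypothesis k_ge0 : forall t s, t \in `[0, 1] -> s \in `[0, 1] -> 0 <= k t s.
Hypothesis H_cont : cont_on_ball rho H.
Hypothesis H_bnd : forall u, C01 u -> supnorm u <= rho -> Hlo <= H u /\ H u <= Hup.
Hypothesis f_cont :
  {within [set p : R * R * R | p.1.1 \in `[0, 1] /\ p.1.2 \in `[- rho, rho]
                               /\ p.2 \in `[Hlo, Hup]],
     continuous (fun p => f p.1.1 p.1.2 p.2)}.
Hypotheses (flo_cont : C01 flo) (fup_cont : C01 fup).
Hypothesis f_bnd : forall t x y,
  t \in `[0, 1] -> x \in `[- rho, rho] -> y \in `[Hlo, Hup] ->
  flo t <= f t x y /\ f t x y <= fup t.

Definition hammerstein (u : R -> R) (t : R) : R :=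
  I01 (fun s => k t s * f s (u s) (H u)).

Let square_compact :
  compact [set p : R * R | p.1 \in `[0, 1] /\ p.2 \in `[0, 1]].
Proof. exact: (compact_setX (@segment_compact R 0 1) (@segment_compact R 0 1)). Qed.

Lemma kernel_uniform e : 0 < e -> exists2 d, 0 < d & forall t s t' s',
  t \in `[0, 1] -> s \in `[0, 1] -> t' \in `[0, 1] -> s' \in `[0, 1] ->
  `|t - t'| < d -> `|s - s'| < d -> `|k t s - k t' s'| < e.
Proof.
move=> e0; have [d d0 dP] :=
  compact_uniform_continuity _ _ _ _ square_compact k_cont _ e0.
by exists d => // t s t' s' *; apply: (dP (t, s) (t', s')).
Qed.

Lemma kernel_bounded : exists2 K, 0 < K & forall t s,
  t \in `[0, 1] -> s \in `[0, 1] -> `|k t s| <= K.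
Proof.
have in01 : (0 : R) \in `[0, 1] by rewrite in_itv /= lexx ler01.
have [|c _ cP] := compact_EVT_max _ square_compact k_cont.
  by exists (0, 0).
exists (`|k c.1 c.2| + 1); first by rewrite ltr_wpDl.
move=> t s t01 s01; rewrite ger0_norm ?k_ge0 //.
apply: le_trans (_ : k c.1 c.2 <= _); first by apply: (cP (t, s)); rewrite inE.
by rewrite (le_trans (ler_norm _)) // lerDl.
Qed.

Lemma nonlinearity_uniform e : 0 < e -> exists2 d, 0 < d &
  forall t x y t' x' y', t \in `[0, 1] -> x \in `[- rho, rho] ->
  y \in `[Hlo, Hup] -> t' \in `[0, 1] -> x' \in `[- rho, rho] ->
  y' \in `[Hlo, Hup] -> `|t - t'| < d -> `|x - x'| < d -> `|y - y'| < d ->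
  `|f t x y - f t' x' y'| < e.
Proof.
move=> e0; pose A := [set p : R * R * R | p.1.1 \in `[0, 1] /\
  p.1.2 \in `[- rho, rho] /\ p.2 \in `[Hlo, Hup]].
have cA : compact A.
  rewrite (_ : A = `[0, 1] `*` `[- rho, rho] `*` `[Hlo, Hup]).
    by apply: compact_setX; [apply: compact_setX|]; exact: segment_compact.
  by apply/seteqP; split=> [p [? [? ?]]|p [[? ?] ?]].
have [d d0 dP] := compact_uniform_continuity _ _ _ _ cA f_cont _ e0.
by exists d => // t x y t' x' y' *; apply: (dP (t, x, y) (t', x', y')).
Qed.

Lemma nonlinearity_bounded : exists2 M, 0 < M & forall t x y,
  t \in `[0, 1] -> x \in `[- rho, rho] -> y \in `[Hlo, Hup] ->
  `|f t x y| <= M.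
Proof.
have [M1 M10 M1P] := C01_bounded _ flo flo_cont.
have [M2 M20 M2P] := C01_bounded _ fup fup_cont.
exists (M1 + M2); first exact: addr_gt0.
move=> t x y t01 xr yH; have [f1 f2] := f_bnd _ _ _ t01 xr yH.
move: (M1P t t01) (M2P t t01); rewrite !ler_norml => /andP[? ?] /andP[? ?].
by apply/andP; split; lra.
Qed.

Lemma C01_ballP u : C01_ball rho u <-> C01 u /\ supnorm u <= rho.
Proof.
split=> -[cu ur]; split=> //; first exact: supnorm_le.
by move=> t t01; apply: le_trans ur; exact: supnorm_ub.
Qed.

Lemma ball_itv u t : C01_ball rho u -> t \in `[0, 1] -> u t \in `[- rho, rho].
Proof. by move=> [_ ur] t01; rewrite in_itv /= -ler_norml; exact: ur. Qed.

Lemma H_itv u : C01_ball rho u -> H u \in `[Hlo, Hup].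
Proof.
by move=> /C01_ballP[cu ur]; rewrite in_itv /=; apply/andP; exact: H_bnd.
Qed.

Lemma C01_kernel t : t \in `[0, 1] -> C01 (k t).
Proof.
move=> t01; apply/C01P => s s01 e e0; have [d d0 dP] := kernel_uniform e e0.
by exists d => // s' s'01 ss'; apply: dP => //; rewrite subrr normr0.
Qed.

Lemma C01_nonlinearity u : C01_ball rho u -> C01 (fun s => f s (u s) (H u)).
Proof.
move=> ub; have [cu _] := ub; apply/C01P => s s01 e e0.
have [d d0 dP] := nonlinearity_uniform e e0.
have [d' d'0 d'P] := (C01P _ u).1 cu s s01 d d0.
exists (Num.min d d'); first by rewrite lt_min d0 d'0.
move=> s' s'01; rewrite lt_min => /andP[ss1 ss2].
apply: dP => //; rewrite ?subrr ?normr0 //; try exact: ball_itv; try exact: H_itv.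
exact: d'P.
Qed.

(** Only the kernel depends on [t], and the nonlinearity is bounded by one [M] over the whole ball,
    so [d] does not depend on [u]. *)
Lemma hammerstein_equicontinuous e : 0 < e -> exists2 d, 0 < d &
  forall u, C01_ball rho u -> forall t s, t \in `[0, 1] -> s \in `[0, 1] ->
    `|t - s| < d -> `|hammerstein u t - hammerstein u s| < e.
Proof.
move=> e0; have [M M0 MP] := nonlinearity_bounded.
have e1 : 0 < e / 2 / M by rewrite !divr_gt0.
have [d d0 dP] := kernel_uniform _ e1; exists d => // u ub t t' t01 t'01 tt'.
apply: (@le_lt_trans _ _ (e / 2)); last lra.
apply: I01_dist => [||s s01].
- by apply: C01M; [exact: C01_kernel|exact: C01_nonlinearity].
- by apply: C01M; [exact: C01_kernel|exact: C01_nonlinearity].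
rewrite -mulrBl normrM -[leRHS](@divfK _ M) ?gt_eqF //; apply: ler_pM => //.
- by apply/ltW/dP => //; rewrite subrr normr0.
- by apply: MP => //; [exact: ball_itv|exact: H_itv].
Qed.

(** Continuity of [H] brings [H v] near [H u]; uniform continuity of [f] then makes the nonlinear
    terms uniformly close, and the kernel is bounded. *)
Lemma hammerstein_continuous u : C01_ball rho u -> forall e, 0 < e ->
  exists2 d, 0 < d & forall v, C01_ball rho v ->
    (forall t, t \in `[0, 1] -> `|u t - v t| <= d) ->
    forall t, t \in `[0, 1] -> `|hammerstein u t - hammerstein v t| <= e.
Proof.
move=> ub e e0; have [K K0 KP] := kernel_bounded.
have e1 : 0 < e / K by rewrite divr_gt0.
have [d d0 dP] := nonlinearity_uniform _ e1.
have /C01_ballP[cu ur] := ub; have [dH dH0 dHP] := H_cont u cu ur d d0.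
pose m := Num.min d dH.
have m0 : 0 < m by rewrite lt_min d0.
have [md mH] : m <= d /\ m <= dH by split; rewrite ge_min lexx ?orbT.
(* Halving turns the weak bound on [u - v] into the strict ones needed for [f] and [H]. *)
exists (m / 2); first by rewrite divr_gt0.
move=> v vb uv t t01; have /C01_ballP[cv vr] := vb.
have HH : `|H u - H v| < d.
  apply: dHP => //; apply: (@le_lt_trans _ _ (m / 2)); first exact: supnorm_le.
  by lra.
apply: I01_dist => [||s s01].
- by apply: C01M; [exact: C01_kernel|exact: C01_nonlinearity].
- by apply: C01M; [exact: C01_kernel|exact: C01_nonlinearity].
rewrite -mulrBr normrM -[leRHS](@divfK _ K) ?gt_eqF // mulrC.
apply: ler_pM => //; last exact: KP.
apply/ltW/dP => //; rewrite ?subrr ?normr0 //; try exact: ball_itv; try exact: H_itv.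
by apply: le_lt_trans (uv s s01) _; lra.
Qed.

Lemma hammerstein_le u t : C01_ball rho u -> t \in `[0, 1] ->
  hammerstein u t <= I01 (fun s => k t s * fup s).
Proof.
move=> ub t01; apply: I01_le => [||s s01].
- by apply: C01M; [exact: C01_kernel|exact: C01_nonlinearity].
- by apply: C01M => //; exact: C01_kernel.
have [_ fu] := f_bnd _ _ _ s01 (ball_itv u s ub s01) (H_itv u ub).
by rewrite ler_wpM2l // k_ge0.
Qed.

Lemma hammerstein_ge u t : C01_ball rho u -> t \in `[0, 1] ->
  I01 (fun s => k t s * flo s) <= hammerstein u t.
Proof.
move=> ub t01; apply: I01_le => [||s s01].
- by apply: C01M => //; exact: C01_kernel.
- by apply: C01M; [exact: C01_kernel|exact: C01_nonlinearity].
have [fl _] := f_bnd _ _ _ s01 (ball_itv u s ub s01) (H_itv u ub).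
by rewrite ler_wpM2l // k_ge0.
Qed.

Lemma C01_hammerstein u : C01_ball rho u -> C01 (hammerstein u).
Proof.
move=> ub; apply/C01P => t t01 e e0.
have [d d0 dP] := hammerstein_equicontinuous e e0.
by exists d => // s s01; exact: dP.
Qed.

(** At the given point all images of the ball have one sign and are bounded away from 0 by the
    integral of [fup] or [flo], whose absolute value is [c]. *)
Lemma hammerstein_supnorm_ge :
  ((exists2 t, t \in `[0, 1] & I01 (fun s => k t s * fup s) < 0) \/
   (exists2 t, t \in `[0, 1] & 0 < I01 (fun s => k t s * flo s))) ->
  exists2 c, 0 < c & forall u, C01_ball rho u -> c <= supnorm (hammerstein u).
Proof.
move=> [[t t01 F0]|[t t01 F0]].
  exists (- I01 (fun s => k t s * fup s)); first by rewrite oppr_gt0.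
  move=> u ub; apply: le_trans (supnorm_ub _ _ _ (C01_hammerstein u ub) t01).
  by rewrite -normrN; apply: le_trans (ler_norm _); rewrite lerN2 hammerstein_le.
exists (I01 (fun s => k t s * flo s)) => // u ub.
apply: le_trans (supnorm_ub _ _ _ (C01_hammerstein u ub) t01).
by apply: le_trans (hammerstein_ge u t ub t01) (ler_norm _).
Qed.

(** At the point [t], [|l| * c] is at most [|l| * |hammerstein u t| = |u t|], hence at most
    [rho]. *)
Lemma hammerstein_eigenvalue_le l u t c : C01_ball rho u -> t \in `[0, 1] ->
  u t = l * hammerstein u t -> 0 < c -> c <= `|hammerstein u t| ->
  `|l| <= rho / c.
Proof.
move=> [_ ur] t01 ut c0 ch; rewrite ler_pdivlMr //.
apply: le_trans (ur t t01); rewrite ut normrM.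
exact: ler_wpM2l.
Qed.

End HammersteinOperator.

(** * Eigenvalues of both signs and their localisation *)

Theorem theorem2p2 (R : realType) (rho : R)
  (k : R -> R -> R) (H : (R -> R) -> R) (f : R -> R -> R -> R)
  (Hlo Hup : R) (flo fup : R -> R) :
  0 < rho ->
  (* (1) *)
  {within [set p : R * R | p.1 \in `[0, 1] /\ p.2 \in `[0, 1]],
     continuous (fun p => k p.1 p.2)} ->
  (forall t s, t \in `[0, 1] -> s \in `[0, 1] -> 0 <= k t s) ->
  (* (2) *)
  cont_on_ball rho H ->
  (forall u, C01 u -> supnorm u <= rho -> Hlo <= H u /\ H u <= Hup) ->
  (* (3) *)
  {within [set p : R * R * R | p.1.1 \in `[0, 1] /\ p.1.2 \in `[- rho, rho]
                               /\ p.2 \in `[Hlo, Hup]],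
     continuous (fun p => f p.1.1 p.1.2 p.2)} ->
  (* (4) *)
  C01 flo -> C01 fup ->
  (forall t x y, t \in `[0, 1] -> x \in `[- rho, rho] -> y \in `[Hlo, Hup] ->
     flo t <= f t x y /\ f t x y <= fup t) ->
  (* (5) *)
  ((exists2 t, t \in `[0, 1] & I01 (fun s => k t s * fup s) < 0) \/
   (exists2 t, t \in `[0, 1] & 0 < I01 (fun s => k t s * flo s))) ->
  (exists (lp lm : R) (up um : R -> R),
     [/\ 0 < lp /\ lm < 0,
         C01 up /\ supnorm up = rho,
         C01 um /\ supnorm um = rho,
         (forall t, t \in `[0, 1] ->
            up t = lp * I01 (fun s => k t s * f s (up s) (H up))) &
         (forall t, t \in `[0, 1] ->
            um t = lm * I01 (fun s => k t s * f s (um s) (H um)))]) /\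
  (forall (l : R) (u : R -> R), C01 u -> supnorm u <= rho ->
     (forall t, t \in `[0, 1] -> u t = l * I01 (fun s => k t s * f s (u s) (H u))) ->
     (forall tr, tr \in `[0, 1] -> I01 (fun s => k tr s * fup s) < 0 ->
        `|l| <= - (rho / I01 (fun s => k tr s * fup s))) /\
     (forall tr, tr \in `[0, 1] -> 0 < I01 (fun s => k tr s * flo s) ->
        `|l| <= rho / I01 (fun s => k tr s * flo s))).
Proof.
move=> rho0 k_cont k_ge0 H_cont H_bnd f_cont flo_cont fup_cont f_bnd F.
have [c c0 cP] := hammerstein_supnorm_ge _ _ _ _ _ _ _ _ _ k_cont k_ge0 H_bnd
  f_cont flo_cont fup_cont f_bnd F.
have BK sg : `|sg| = 1 -> exists l u, [/\ 0 < l, C01 u, supnorm u = rho &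
    forall t, t \in `[0, 1] -> u t = sg * l * hammerstein R k H f u t].
  move=> sg1; apply: birkhoff_kellogg_C01 rho0 c0 sg1 _ _ cP.
    exact: (hammerstein_equicontinuous _ _ _ _ _ _ _ _ _ k_cont H_bnd f_cont
      flo_cont fup_cont f_bnd).
  exact: (hammerstein_continuous _ _ _ _ _ _ _ k_cont k_ge0 H_cont H_bnd f_cont).
split.
  (* The signs 1 and -1 give the two eigenpairs; the negative eigenvalue is [- lm]. *)
  have [lp [up [lp0 Cup nup eup]]] := BK 1 (normr1 _).
  have [lm [um [lm0 Cum num eum]]] := BK (- 1) (normrN1 _).
  exists lp, (- lm), up, um; split=> //; first by rewrite oppr_lt0.
    by move=> t t01; rewrite eup // mul1r.
  by move=> t t01; rewrite eum // mulN1r.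
move=> l u Cu ur eu; have ub : C01_ball rho u by apply/C01_ballP.
split=> t t01 F0.
  rewrite -mulrN -invrN.
  apply: (hammerstein_eigenvalue_le _ _ k H f l u t) => //.
  - exact: eu.
  - by rewrite oppr_gt0.
  - rewrite -normrN; apply: le_trans (ler_norm _); rewrite lerN2.
    exact: (hammerstein_le _ _ _ _ _ _ _ _ _ k_cont k_ge0 H_bnd f_cont
      fup_cont f_bnd).
apply: (hammerstein_eigenvalue_le _ _ k H f l u t) => //; first exact: eu.
apply: le_trans (ler_norm _).
exact: (hammerstein_ge _ _ _ _ _ _ _ _ _ k_cont k_ge0 H_bnd f_cont flo_cont f_bnd).
Qed.
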